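(* Let $G$ be the free product of the free Abelian groups $\mathbb{Z}^n$, $n\ge 1$, where the free factor $\mathbb{Z}^n$ is freely generated (as an Abelian group) by $a_{1,n},\dots,a_{n,n}$. Let $p\colon\mathbb{N}\to\mathbb{N}$ be an increasing function, and assign to each $a_{i,n}$ a weight $w_{i,n}$ with $n\le w_{i,n}\le p(n)$. For $g\in G$ let $L_p(g)$ be the smallest weight of a word in the letters $a_{i,n}^{\pm1}$ representing $g$, where the weight of a word is the sum of the weights of its letters and $a_{i,n}^{-1}$ has the same weight as $a_{i,n}$. Then $L_p$ is a length function on $G$, the group $G$ does not have property RD with respect to $L_p$, and $G$ has no amenable subgroup of superpolynomial growth with respect to $L_p$.
   Context: A length function is a map $L\colon G\to[0,\infty)$ with $L(gh)\le L(g)+L(h)$, $L(g)=L(g^{-1})$, $L(1)=0$. Property RD: for finitely supported $\phi,\psi\colon G\to[0,\infty)$ put $\|\phi\|=\sqrt{\sum_{g}\phi(g)^2}$, $\phi*\psi(k)=\sum_{g}\phi(g)\psi(g^{-1}k)$, $\mathrm{prop}(\phi)=\max\{L(g): \phi(g)\ne 0\}$. $G$ has property RD with respect to $L$ if there is a polynomial $P$ (with non-negative coefficients) such that for every $r>0$ and all finitely supported $\phi,\psi\colon G\to[0,\infty)$ with $\mathrm{prop}(\phi)\le r$ one has $\|\phi*\psi\|^2\le P(r)\|\phi\|^2\|\psi\|^2$. The growth of a subgroup $A\le G$ with respect to $L$ is the function $r\mapsto|\{a\in A: L(a)\le r\}|$; it is superpolynomial if it is not bounded above by any polynomial in $r$.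 *)

(* Defs.v *)
From HB Require Import structures.
From mathcomp Require Import all_boot all_order all_algebra.
From mathcomp Require Import finmap.
From mathcomp Require Import boolp classical_sets functions cardinality fsbigop.
From mathcomp Require Import reals ereal measure.

Set Implicit Arguments.
Unset Strict Implicit.
Unset Printing Implicit Defensive.

Import Order.TTheory GRing.Theory Num.Theory.

Local Open Scope classical_set_scope.
Local Open Scope ring_scope.

(* The free product of a family of groups, as the group of reduced words:
   sequences of nontrivial syllables in which adjacent syllables belong to
   distinct factors. *)
Section FreeProduct.
Variables (I : choiceType) (A : I -> groupType).

Definition syllable : choiceType := {i : I & A i}.
Local Notation syl := (Tagged (fun i => A i : Type)) (only parsing).

Definition reduced (s : seq syllable) : bool :=
  all (fun x : syllable => tagged x != 1%g) s &&
  sorted (fun x y : syllable => tag x != tag y) s.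

Record freeProd := FreeProd { fpword :> seq syllable; _ : reduced fpword }.

HB.instance Definition _ := [isSub for fpword].
HB.instance Definition _ := [Choice of freeProd by <:].

(* [tagged_as x y] is [tagged y] cast to the factor of [x]; the cast is only
   used when [x] and [y] lie in the same factor. *)
Definition fpcons (x : syllable) (s : seq syllable) : seq syllable :=
  if tagged x == 1%g then s else
  if s isn't y :: s' then [:: x] else
  if tag x != tag y then x :: s else
  let z := (tagged x * tagged_as x y)%g in
  if z == 1%g then s' else syl z :: s'.

Definition fpcat (s t : seq syllable) : seq syllable := foldr fpcons t s.

Definition sylV (x : syllable) : syllable :=
  syl (tagged x)^-1%g.

Lemma reduced_behead x s : reduced (x :: s) -> reduced s.
Proof.
by case/andP => /= /andP[_ hs] /path_sorted hp; rewrite /reduced hs hp.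
Qed.

Lemma fpcons_reduced x s : reduced s -> reduced (fpcons x s).
Proof.
rewrite /fpcons; case: eqP => // /eqP x1.
case: s => [_|y s rs]; first by rewrite /reduced /= x1.
case: ifP => [xy|/negbFE/eqP xy].
  by case/andP: rs => /= h1 h2; rewrite /reduced /= x1 h1 xy h2.
case: eqP => [_|/eqP z1]; first exact: reduced_behead rs.
case/andP: rs => /= /andP[_ h1] h2; rewrite /reduced /= z1 h1 /=.
by case: s h1 h2 => //= u s _; rewrite xy.
Qed.

Lemma fpcat_reduced s t : reduced t -> reduced (fpcat s t).
Proof. by move=> rt; elim: s => //= x s; apply: fpcons_reduced. Qed.

Lemma fpcons_id x s : reduced (x :: s) -> fpcons x s = x :: s.
Proof.
rewrite /fpcons /reduced /= => /andP[/andP[/negbTE -> _]].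
by case: s => //= y s /andP[-> _].
Qed.

Lemma fpconsM (i : I) (a b : A i) s : reduced s ->
  fpcons (syl a)
    (fpcons (syl b) s) =
  fpcons (syl (a * b)%g) s.
Proof.
move=> rs; rewrite {2}/fpcons /=.
have [->|b1] := eqVneq b 1%g; first by rewrite mulg1.
case: s rs => [_|y s rs].
  rewrite /fpcons /= tagged_asE eqxx /=.
  by have [->|//] := eqVneq a 1%g; rewrite mul1g (negbTE b1).
case: (eqVneq i (tag y)) rs => [|iy rs] /=; last first.
  rewrite /fpcons /= iy eqxx /= tagged_asE.
  have [->|a1] := eqVneq a 1%g; first by rewrite mul1g (negbTE b1).
  by case: eqP.
case: y => j c /= ij; subst j => rs; rewrite tagged_asE.
have c1 : c != 1%g by case/andP: rs => /= /andP[].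
rewrite [in RHS]/fpcons /= eqxx /= tagged_asE.
have [bc|bc] := eqVneq (b * c)%g 1%g; last first.
  rewrite /fpcons /= eqxx /= tagged_asE mulgA.
  have [->|a1] := eqVneq a 1%g; first by rewrite mul1g (negbTE b1) (negbTE bc).
  have [ab|//] := eqVneq (a * b)%g 1%g.
  by rewrite ab mul1g (negbTE c1).
have -> : b = (c^-1)%g by rewrite -[b]mulg1 -(mulgV c) mulgA bc mul1g.
rewrite -mulgA mulVg mulg1.
have [ac|ac] := eqVneq (a * c^-1)%g 1%g.
  have -> : a = c by rewrite -[a]mulg1 -(mulVg c) mulgA ac mul1g.
  by rewrite fpcons_id.
rewrite /fpcons /=; case: eqP => // _.
case: s rs => //= z s rs.
suff -> : i != tag z by [].
by case/andP: rs => _ /= /andP[].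
Qed.

Lemma fpcat_cons x s t : reduced s -> reduced t ->
  fpcat (fpcons x s) t = fpcons x (fpcat s t).
Proof.
move=> rs rt; have [x1|x1] := eqVneq (tagged x) 1%g.
  by rewrite /fpcons x1 eqxx.
rewrite [fpcons x s]/fpcons (negbTE x1).
case: s rs => //= y s rs; case: ifPn => //=.
case: x x1 => i a /= a1; case: y rs => j b rs; rewrite negbK => /= /eqP ij.
subst j; rewrite tagged_asE fpconsM; last exact: fpcat_reduced.
by case: eqP => [->|//]; rewrite /fpcons /= eqxx.
Qed.

Lemma fpcatA s t u : reduced t -> reduced u ->
  fpcat s (fpcat t u) = fpcat (fpcat s t) u.
Proof.
move=> rt ru; elim: s => //= x s ->.
by rewrite fpcat_cons// fpcat_reduced.
Qed.

Lemma fpcats0 s : reduced s -> fpcat s [::] = s.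
Proof.
elim: s => //= x s IH rs.
by rewrite IH ?fpcons_id //; apply: reduced_behead rs.
Qed.

Definition fpinv (s : seq syllable) : seq syllable := rev (map sylV s).

Lemma fpinv_reduced s : reduced s -> reduced (fpinv s).
Proof.
case/andP=> h1 h2; apply/andP; split.
  rewrite /fpinv all_rev all_map; apply: sub_all h1 => x /=.
  by apply: contra_neq => xV; rewrite -[tagged x]invgK xV invg1.
rewrite /fpinv rev_sorted sorted_map.
by apply: sub_sorted h2 => x y /=; rewrite eq_sym.
Qed.

Lemma fpcatV s : reduced s -> fpcat (fpinv s) s = [::].
Proof.
rewrite /fpinv; elim: s => // x s IH rs.
have rs' := reduced_behead rs; rewrite -{2}(fpcons_id rs).
rewrite map_cons rev_cons -cats1 /fpcat foldr_cat /=.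
case: x rs => i a rs; rewrite fpconsM// mulVg /fpcons /= eqxx.
exact: IH.
Qed.

Lemma fpinvK : involutive fpinv.
Proof.
move=> s; rewrite /fpinv map_rev revK -map_comp map_id_in// => -[i a] _ /=.
by rewrite /sylV /= invgK.
Qed.

Definition fpone : freeProd := @FreeProd [::] isT.
Definition fpmul (s t : freeProd) : freeProd :=
  FreeProd (fpcat_reduced s (valP t)).
Definition fpinvg (s : freeProd) : freeProd :=
  FreeProd (fpinv_reduced (valP s)).

Lemma fpmulA : associative fpmul.
Proof. by move=> s t u; apply/val_inj/fpcatA; apply: valP. Qed.
Lemma fpmul1 : left_id fpone fpmul.
Proof. by move=> s; apply/val_inj. Qed.
Lemma fpmulr1 : right_id fpone fpmul.
Proof. by move=> s; apply/val_inj/fpcats0/valP. Qed.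
Lemma fpmulV : left_inverse fpone fpinvg fpmul.
Proof. by move=> s; apply/val_inj/fpcatV/valP. Qed.
Lemma fpmulrV : right_inverse fpone fpinvg fpmul.
Proof.
move=> s; apply/val_inj => /=; rewrite -{1}(fpinvK s).
exact/fpcatV/fpinv_reduced/valP.
Qed.

HB.instance Definition _ :=
  isGroup.Build freeProd fpmulA fpmul1 fpmulr1 fpmulV fpmulrV.

Definition fpin (i : I) (a : A i) : freeProd :=
  FreeProd (@fpcons_reduced (syl a) [::] isT).

Lemma fpinM i : {morph @fpin i : a b / (a * b)%g}.
Proof.
move=> a b; apply/val_inj => /=.
rewrite -fpconsM// -/(fpcat [:: _] (fpcons _ [::])).
rewrite -[RHS]/(fpcat (fpcons (syl a) [::]) _).
by rewrite fpcat_cons// fpcons_reduced.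
Qed.

HB.instance Definition _ i :=
  isMultiplicative.Build (A i) freeProd (@fpin i) (@fpinM i).

Lemma fpin1 i : fpin (1%g : A i) = 1%g.
Proof. by apply/val_inj; rewrite /= /fpcons /= eqxx. Qed.

Lemma fp_ind (P : freeProd -> Prop) :
  P 1%g -> (forall i (a : A i) g, P g -> P (fpin a * g)%g) -> forall g, P g.
Proof.
move=> P1 PM [s rs]; elim: s rs => [|[i a] s IH] rs.
  by rewrite (_ : FreeProd rs = 1%g)//; apply/val_inj.
have rs' := reduced_behead rs.
rewrite (_ : FreeProd rs = (fpin a * FreeProd rs')%g); first exact/PM/IH.
apply/val_inj; rewrite /= -(fpcons_id rs).
by rewrite fpcat_cons.
Qed.

(* The defining universal property of the free product. *)
Lemma freeProd_universal (H : groupType)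
    (f : forall i, {multiplicative A i -> H}) :
  exists! F : freeProd -> H,
    {morph F : g h / (g * h)%g} /\ forall i (a : A i), F (fpin a) = f i a.
Proof.
have f1 i : f i 1%g = 1%g.
  by apply: (mulgI (f i 1%g)); rewrite mulg1 -gmulfM mulg1.
pose F0 (s : seq syllable) :=
  foldr (fun x h => (f (tag x) (tagged x) * h)%g) 1%g s.
have F0cons x s : F0 (fpcons x s) = (f (tag x) (tagged x) * F0 s)%g.
  rewrite /fpcons; case: eqP => [->|_]; first by rewrite f1 mul1g.
  case: s => // y s; case: ifPn => //; case: x y => [i a] [j b] /=.
  rewrite negbK => /eqP ij; subst j; rewrite tagged_asE mulgA -gmulfM.
  by case: eqP => [->|//]; rewrite f1 mul1g.
pose F (g : freeProd) := F0 g.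
have FM : {morph F : g h / (g * h)%g}.
  move=> [s rs] h; rewrite /F /=; elim: s rs => [|x s IH] rs /=.
    by rewrite mul1g.
  by rewrite F0cons IH ?mulgA//; apply: reduced_behead rs.
have Fin i (a : A i) : F (fpin a) = f i a by rewrite /F F0cons /= mulg1.
exists F; split=> // F' [F'M F'in].
apply/funext; apply: fp_ind => [|i a g Fg]; last first.
  by rewrite FM F'M Fin F'in Fg.
suff -> : F' 1%g = 1%g by [].
by apply: (mulgI (F' 1%g)); rewrite -F'M [in LHS]mul1g mulg1.
Qed.

End FreeProduct.

Section LengthFunctions.
Variables (R : realType) (G : groupType).
Implicit Types (L phi psi : G -> R) (A : set G).

Definition length_function L : Prop :=
  [/\ forall g, 0 <= L g,
      forall g h, L (g * h)%g <= L g + L h,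
      forall g, L g = L (g^-1)%g &
      L 1%g = 0].

Definition finitely_supported phi : Prop := finite_set [set g | phi g != 0].

Definition l2norm phi : R := Num.sqrt (\sum_(g \in [set: G]) phi g ^+ 2).

Definition convolution phi psi : G -> R :=
  fun k => \sum_(g \in [set: G]) phi g * psi (g^-1 * k)%g.

(* The maximum over the empty support is 0 by convention. *)
Definition propagation L phi : R :=
  \big[Num.max/0]_(g <- fset_set [set g | phi g != 0]) L g.

Definition property_RD L : Prop :=
  exists2 P : {poly R}, (forall i, 0 <= P`_i) &
    forall r, 0 < r -> forall phi psi,
      finitely_supported phi -> finitely_supported psi ->
      (forall g, 0 <= phi g) -> (forall g, 0 <= psi g) ->
      propagation L phi <= r ->
      l2norm (convolution phi psi) ^+ 2 <=
        P.[r] * l2norm phi ^+ 2 * l2norm psi ^+ 2.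

Definition subgroup A : Prop :=
  [/\ A 1%g, forall g h, A g -> A h -> A (g * h)%g &
      forall g, A g -> A (g^-1)%g].

(* Amenability of a subgroup [A], as a discrete group: there is a finitely
   additive probability measure, defined on all subsets of [A], which is
   invariant under left translation by [A].  The values of [mu] on sets not
   contained in [A] are irrelevant. *)
Definition amenable A : Prop :=
  exists mu : set G -> R,
    [/\ forall X, X `<=` A -> 0 <= mu X,
        mu A = 1,
        forall X Y, X `<=` A -> Y `<=` A -> X `&` Y = set0 ->
          mu (X `|` Y) = mu X + mu Y &
        forall a X, A a -> X `<=` A -> mu [set (a * x)%g | x in X] = mu X].

(* Extended-real valued: [+oo] when the ball is infinite. *)
Definition growth L A (r : R) : \bar R := counting [set a | A a /\ L a <= r].

Definition superpolynomial (f : R -> \bar R) : Prop :=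
  ~ exists P : {poly R}, forall r, 0 <= r -> (f r <= P.[r]%:E)%E.

End LengthFunctions.

(* The factor of index [n] has rank [n.+1], so that the ranks run through the
   positive integers. *)
Definition Zpower (n : nat) : groupType :=
  Algebra.to_multiplicative 'rV[int]_n.+1.

Definition freeProdZ : groupType := freeProd Zpower.

Definition gen (n : nat) (i : 'I_n.+1) : freeProdZ :=
  @fpin _ Zpower n (delta_mx 0 i : 'rV[int]_n.+1).

(* [(a, true)] stands for the inverse of the generator indexed by [a]. *)
Definition letter : choiceType := ({n : nat & 'I_n.+1} * bool)%type.

Definition letter_val (x : letter) : freeProdZ :=
  let a := gen (tagged x.1) in if x.2 then (a^-1)%g else a.

Definition word_val (s : seq letter) : freeProdZ :=
  (\prod_(x <- s) letter_val x)%g.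

Section WordLength.
Variables (R : realType) (w : forall n : nat, 'I_n.+1 -> R).

Definition weight (s : seq letter) : R := \sum_(x <- s) w (tagged x.1).

Definition weighted_length (g : freeProdZ) : R :=
  inf [set weight s | s in [set s | word_val s = g]].

End WordLength.

Lemma word_val_cat s t : word_val (s ++ t) = (word_val s * word_val t)%g.
Proof. exact: big_cat. Qed.

Lemma word_val_onto (g : freeProdZ) : exists s, word_val s = g.
Proof.
elim/fp_ind: g => [|n a g [t <-]].
  by exists [::]; rewrite /word_val big_nil.
suff [s <-] : exists s, word_val s = @fpin _ Zpower n a.
  by exists (s ++ t); rewrite word_val_cat.
pose S (v : 'rV[int]_n.+1) := exists s, word_val s = @fpin _ Zpower n v.
have S0 : S 0.
  by exists [::]; rewrite /word_val big_nil -(@fpin1 _ Zpower n).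
have SD u v : S u -> S v -> S (u + v).
  move=> [s su] [s' sv]; exists (s ++ s'); rewrite word_val_cat su sv.
  by rewrite -(@fpinM _ Zpower n u v).
have Sgen (i : 'I_n.+1) : S (delta_mx 0 i).
  exists [:: (Tagged (fun n => 'I_n.+1) i, false)].
  by rewrite /word_val big_seq1.
have SgenN (i : 'I_n.+1) : S (- delta_mx 0 i).
  exists [:: (Tagged (fun n => 'I_n.+1) i, true)].
  rewrite /word_val big_seq1 /letter_val /= /gen.
  set x := fpin _; set y := fpin _.
  suff xy : (x * y = 1)%g by rewrite -[LHS]mulg1 -xy mulgA mulVg mul1g.
  rewrite /x /y -(@fpinM _ Zpower n (delta_mx 0 i) (- delta_mx 0 i)).
  rewrite -(@fpin1 _ Zpower n); congr fpin; exact: addrN.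
have Sn v k : S v -> S (v *+ k).
  by move=> Sv; elim: k => [|k IH]; rewrite ?mulr0n// mulrS; apply: SD.
rewrite -/(S a) [a]row_sum_delta; apply: big_ind => // i _.
rewrite -[_ *: _]/(_ *: _ : 'rV[int]_n.+1) -[X in X *: _]intz scaler_int.
case: ((a : 'rV[int]_n.+1) 0 i) => k; first exact: Sn.
by rewrite NegzE mulrNz -mulNrz; apply: Sn.
Qed.

Section WeightedLengthMin.
Variables (R : realType) (w : forall n : nat, 'I_n.+1 -> R).
Hypothesis w_ge : forall n (i : 'I_n.+1), n.+1%:R <= @w n i.

Lemma weight_ge0 s : 0 <= weight w s.
Proof. by apply: sumr_ge0 => x _; apply: le_trans (w_ge _). Qed.

Lemma finite_words_le (W : R) : exists l : seq (seq letter),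
  forall s, weight w s <= W -> s \in l.
Proof.
have [N WN] : exists N : nat, W <= N%:R.
  exists (Num.bound `|W|); apply/ltW/(le_lt_trans (ler_norm W)).
  exact: archi_boundP.
pose al : seq letter := flatten [seq [seq (Tagged (fun n => 'I_n.+1) i, b) |
  i <- enum 'I_n.+1, b <- [:: true; false]] | n <- iota 0 N].
have alP (x : letter) : (tag x.1 < N)%N -> x \in al.
  case: x => [[n i] b] /= nN; apply/flattenP.
  exists [seq (Tagged (fun n => 'I_n.+1) i, b) |
    i <- enum 'I_n.+1, b <- [:: true; false]].
    by apply: map_f; rewrite mem_iota.
  apply/allpairsP; exists (i, b); split => //=; first by rewrite mem_enum.
  by case: b; rewrite !inE.
pose fix ws k := if k is k'.+1 then
  [::] :: [seq x :: s | x <- al, s <- ws k'] else [:: [::]] : seq (seq letter).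
have wsP k s : (size s <= k)%N -> all [in al] s -> s \in ws k.
  elim: k s => [|k IH] [|x s] //= sk /andP[xl sl].
  rewrite inE; apply/orP; right.
  by apply/allpairsP; exists (x, s); split => //=; apply: IH.
exists (ws N) => s sW; apply: wsP.
  rewrite -(ler_nat R); apply: le_trans WN; apply: le_trans sW.
  rewrite /weight -sum1_size natr_sum; apply: ler_sum => x _.
  by apply: le_trans (w_ge _); rewrite ler1n.
apply/allP => x xs; apply: alP; rewrite -(ler_nat R).
apply: le_trans WN; apply: le_trans sW; apply: le_trans (w_ge (tagged x.1)) _.
rewrite /weight (big_rem x)//= lerDl.
by apply: sumr_ge0 => y _; apply: le_trans (w_ge _).
Qed.

(* The infimum defining the weighted length is a minimum. *)
Lemma weighted_length_min g :
  (exists2 s, word_val s = g & weight w s = weighted_length w g) /\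
  (forall s, word_val s = g -> weighted_length w g <= weight w s).
Proof.
have lb : has_lbound [set weight w s | s in [set s | word_val s = g]].
  by exists 0 => _ [s _ <-]; apply: weight_ge0.
have le s : word_val s = g -> weighted_length w g <= weight w s.
  by move=> sg; apply: ge_inf => //; exists s.
split=> //; have [s0 s0g] := word_val_onto g.
have [l lP] := finite_words_le (weight w s0).
have [s [sg smin]] : exists s, word_val s = g /\
    forall t, t \in l -> word_val t = g -> weight w s <= weight w t.
  elim: l {lP} => [|x l [s [sg smin]]]; first by exists s0.
  have [xg|xg] := eqVneq (word_val x) g; last first.
    exists s; split=> // t; rewrite inE => /predU1P[-> xg'|]; last exact: smin.
    by rewrite xg' eqxx in xg.
  have [sx|xs] := leP (weight w s) (weight w x).
    by exists s; split=> // t; rewrite inE => /predU1P[->//|]; apply: smin.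
  exists x; split=> // t; rewrite inE => /predU1P[->//|tl tg].
  exact/(le_trans (ltW xs))/smin.
exists s => //; apply/eqP; rewrite eq_le le// andbT.
apply: lb_le_inf; first by exists (weight w s); exists s.
move=> _ [t tg <-].
have [ts0|/ltW s0t] := leP (weight w t) (weight w s0).
  exact/smin/tg/lP.
by apply: le_trans s0t; apply: smin => //; apply: lP.
Qed.

End WeightedLengthMin.

(* Main.v *)
Require Import Defs.
From mathcomp Require Import all_boot all_order all_algebra.
From mathcomp Require Import zify ring lra finmap.
From mathcomp Require Import boolp classical_sets functions cardinality fsbigop.
From mathcomp Require Import reals ereal measure.

Set Implicit Arguments.
Unset Strict Implicit.
Unset Printing Implicit Defensive.

Import Order.TTheory GRing.Theory Num.Theory.

Local Open Scope classical_set_scope.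
Local Open Scope ring_scope.

(** The weighted length is a length function because the words representing
    two elements can be concatenated, and a word can be inverted letter by
    letter without changing its weight.

    Property RD fails because the factors have unbounded rank.  If [Y Y^-1] is
    contained in [X], and [X] in the ball of radius [r], then property RD,
    applied to the indicator functions of [X] and [Y], gives
    [|Y|^2 <= P(r) |X|] ([property_RD_fsets]).  For cubes of side [K] in a
    factor [Z^m] this reads [K^(2m) <= P(r) (2K)^m] with [r] linear in [K]; it
    is violated for large [K] as soon as [m] exceeds the degree of [P]
    ([not_property_RD]).

    Every nontrivial element of a free product is conjugate to an element of a
    factor or to a cyclically reduced word ([conj_fpin_or_cyclically_reduced]).
    Accordingly, after a conjugation, which preserves polynomial growth, there
    are two cases for an amenable subgroup [B].

    If [B] contains a cyclically reduced word [g], consider the set [H] of the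
    reduced words [v] for which [g v] is reduced as it stands.  Then [g] maps
    [H] into [H].  An invariant mean gives the same measure to all the
    translates of [H], so the decreasing sequence [g^k H], for integers [k],
    has null differences; but an element outside [g^-N H \ g^N H] begins with
    [g^N] or with [g^-N] ([mean_begins_along]).  Hence for every [b] in [B]
    there is an [x] such that both [x] and [b x] begin in this way, and
    cancelling in [b = (b x) x^-1] shows that [b = s t^-1] where [s] and [t]
    are prefixes of powers of [g] or [g^-1], no longer than [b] up to a
    constant ([mem_axis_elements]).  The growth of [B] is therefore at most
    quadratic.

    If no conjugate of an element of the subgroup is cyclically reduced, then
    the subgroup is conjugate into a single factor: for [a] in a factor and
    [h] outside it, [a (h a h^-1)] is conjugate to a cyclically reduced word
    ([conj_cyclically_reduced]).  As every generator has weight at least 1, the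
    elements of length at most [N] in the factor have coordinates bounded by
    [N], so the growth is polynomial, of degree the rank of the factor. *)

(** * Reduced words in a free product *)

Section Words.
Variables (I : choiceType) (A : I -> groupType).
Local Notation syll := (syllable A).
Local Notation word := (seq (syllable A)).
Local Notation syl := (Tagged (fun i => A i : Type)) (only parsing).
Implicit Types (x y : syll) (s t u : word) (g h : freeProd A).

Definition follows x t : bool :=
  if t is y :: _ then tag x != tag y else true.

Lemma reduced_cat x s t :
  reduced (x :: s ++ t) =
  [&& reduced (x :: s), reduced t & follows (last x s) t].
Proof.
rewrite /reduced /= all_cat cat_path -!andbA.
case: (tagged x != 1%g) => //=; case: (all _ s) => //=.
case: t => [|y t] /=; first by rewrite !andbT.
case: (_ != 1%g); case: (all _ t) => /=; rewrite ?andbF //.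
by congr (_ && _); rewrite andbC.
Qed.

Lemma reduced_rcons_cat s x t :
  reduced (rcons s x ++ t) = [&& reduced (rcons s x), reduced t & follows x t].
Proof.
case: s => [|y s]; first by rewrite -[x]/(last x [::]) -reduced_cat.
by rewrite /= reduced_cat last_rcons.
Qed.

Lemma reduced_prefix s t : reduced (s ++ t) -> reduced s.
Proof. by case: s => // x s; rewrite /= reduced_cat => /andP[]. Qed.

Lemma fpcat_reduced_cat s t : reduced (s ++ t) -> fpcat s t = s ++ t.
Proof.
elim: s => //= x s IH rst.
by rewrite IH ?fpcons_id //; apply: reduced_behead rst.
Qed.

Lemma size_fpcat s t : (size (fpcat s t) <= size s + size t)%N.
Proof.
elim: s => //= x s IH; rewrite addSn; move: (fpcat s t) IH => u IH.
apply: leq_trans (_ : (size u).+1 <= _)%N; last by rewrite ltnS.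
rewrite /fpcons; case: eqP => //= _; case: u {IH} => //= y u.
by case: ifP => //= _; case: eqP => //= _; apply: leqW; apply: leqW.
Qed.

Lemma fpcat_rcons s x t : fpcat (rcons s x) t = fpcat s (fpcons x t).
Proof. exact: foldr_rcons. Qed.

Lemma fpinv_rcons s x : fpinv (rcons s x) = sylV x :: fpinv s.
Proof. by rewrite /fpinv map_rcons rev_rcons. Qed.

Lemma fpinv_cons x s : fpinv (x :: s) = rcons (fpinv s) (sylV x).
Proof. by rewrite /fpinv map_cons rev_cons. Qed.

Lemma fpinv_cat s t : fpinv (s ++ t) = fpinv t ++ fpinv s.
Proof. by rewrite /fpinv map_cat rev_cat. Qed.

Lemma size_fpinv s : size (fpinv s) = size s.
Proof. by rewrite size_rev size_map. Qed.

(** A product of reduced words is computed by cancelling a suffix of the first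
    factor against a prefix of the second; after that at most one pair of
    syllables is merged, so the length drops by at most one more. *)
Lemma fpcat_cancel s t : reduced s -> reduced t ->
  exists s1 s2 t1, [/\ s = s1 ++ s2, t = fpinv s2 ++ t1,
    fpcat s t = fpcat s1 t1 &
    (size s1 + size t1 <= (size (fpcat s t)).+1)%N].
Proof.
elim/last_ind: s t => [|s x IH] t rs rt.
  by exists [::], [::], t; split.
case: t rt => [|y t] rt.
  by exists (rcons s x), [::], [::]; rewrite cats0 fpcats0// addn0; split.
have [xy|xy] := boolP (tag x != tag y).
  exists (rcons s x), [::], (y :: t); rewrite cats0; split=> //.
  by rewrite fpcat_reduced_cat ?reduced_rcons_cat ?rs ?rt //= size_cat.
move: xy; rewrite negbK; case: x y rs rt => [i a] [j b] /= rs rt /eqP ij.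
subst j; have a1 : a != 1%g.
  by case/andP: rs => /=; rewrite all_rcons => /andP[].
have [ab|ab] := eqVneq (a * b)%g 1%g.
  have rs' : reduced s by move: rs; rewrite -cats1; apply: reduced_prefix.
  have [s1 [s2 [t1 [es et est sz]]]] := IH t rs' (reduced_behead rt).
  have eb : b = (a^-1)%g by rewrite -[b]mul1g -(mulVg a) -mulgA ab mulg1.
  have e : fpcat (rcons s (syl a)) (syl b :: t) = fpcat s t.
    by rewrite fpcat_rcons /fpcons /= (negbTE a1) eqxx /= tagged_asE ab eqxx.
  exists s1, (rcons s2 (syl a)), t1; split=> //.
  - by rewrite -rcons_cat -es.
  - by rewrite fpinv_rcons /sylV /= -et eb.
  - by rewrite e.
  - by rewrite e.
exists (rcons s (syl a)), [::], (syl b :: t); rewrite cats0; split=> //.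
rewrite fpcat_rcons /fpcons /= (negbTE a1) eqxx /= tagged_asE (negbTE ab).
rewrite fpcat_reduced_cat; first by rewrite size_cat size_rcons /= !addnS addSn.
have rt' : reduced (syl (a * b)%g :: t).
  case/andP: rt => /= /andP[_ h1] h2; rewrite /reduced /= ab h1 /=.
  by case: t h1 h2.
case/lastP: s rs {IH} => //= s z; rewrite -cats1 => rs.
rewrite reduced_rcons_cat rt' /=.
by move: rs; rewrite reduced_rcons_cat => /and3P[-> _ /= ->].
Qed.

(** * Conjugacy classes in a free product *)

Lemma val_mulg g h : val (g * h)%g = fpcat (val g) (val h).
Proof. by []. Qed.

Lemma val_fpin i (a : A i) : a != 1%g -> val (fpin a) = [:: syl a].
Proof. by move=> a1; rewrite /= /fpcons /= (negbTE a1). Qed.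

Lemma val_fpin_tagged x : tagged x != 1%g -> val (fpin (tagged x)) = [:: x].
Proof. by move/val_fpin => ->; case: x. Qed.

Lemma fpinV i (a : A i) : fpin (a^-1)%g = ((fpin a)^-1)%g.
Proof.
by apply: (mulgI (fpin a)); rewrite mulgV -fpinM mulgV fpin1.
Qed.

Lemma fpin_inj i : injective (@fpin I A i).
Proof.
move=> a b /(congr1 val) /=; rewrite /fpcons /=.
have [->|a1] := eqVneq a 1%g; have [->|b1] := eqVneq b 1%g => // -[] /eqP.
by rewrite eq_Tagged /= => /eqP.
Qed.

Lemma fpinJ i (a b : A i) : fpin (a ^ b)%g = (fpin a ^ fpin b)%g.
Proof. by rewrite !conjgE !fpinM fpinV. Qed.

Lemma freeProd_syl x (rx : reduced [:: x]) : FreeProd rx = fpin (tagged x).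
Proof.
by apply/val_inj; rewrite val_fpin_tagged//; case/andP: rx => /= /andP[].
Qed.

Definition cyclically_reduced g : bool :=
  (val g != [::]) && reduced (val g ++ val g).

Lemma cyclically_reduced_cons x s (rs : reduced (x :: s)) :
  cyclically_reduced (FreeProd rs) = (tag (last x s) != tag x).
Proof. by rewrite /cyclically_reduced /= reduced_cat rs. Qed.

(** By induction on the length: conjugating by the first syllable shortens a
    word whose first and last syllables lie in the same factor. *)
Lemma conj_fpin_or_cyclically_reduced g : g != 1%g ->
  exists c, (exists i (a : A i), a != 1%g /\ (g ^ c)%g = fpin a) \/
            cyclically_reduced (g ^ c)%g.
Proof.
have [n] := ubnP (size (val g)); elim: n g => // n IH [[|x s] rs] sn g1.
  by case/eqP: g1; apply/val_inj.
case/lastP: s rs sn g1 => [|s y] rs sn g1.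
  exists 1%g; left; exists (tag x), (tagged x); rewrite conjg1 freeProd_syl.
  by split=> //; case/andP: (rs) => /= /andP[].
have [yx|yx] := boolP (tag y != tag x).
  exists 1%g; right; rewrite conjg1 cyclically_reduced_cons.
  by rewrite last_rcons.
set g := FreeProd rs in g1 sn *; pose c := fpin (tagged x).
have rs' : reduced (rcons s y) := reduced_behead rs.
have x1 : tagged x != 1%g by case/andP: (rs) => /= /andP[].
have cE : val c = [:: x] := val_fpin_tagged x1.
have gE : g = (c * FreeProd rs')%g.
  by apply/val_inj; rewrite val_mulg cE /= fpcons_id.
have g'E : (g ^ c)%g = (FreeProd rs' * c)%g.
  by rewrite conjgE gE !mulgA mulVg mul1g.
have sz : (size (val (g ^ c)%g) < n)%N.
  rewrite g'E val_mulg cE fpcat_rcons; apply: leq_ltn_trans (size_fpcat _ _) _.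
  move: sn; rewrite /= size_rcons ltnS; apply: leq_trans; rewrite ltnS addnC.
  rewrite -add1n leq_add2r /fpcons; case: eqP => // _.
  by rewrite (negbTE yx); case: eqP.
have g'1 : (g ^ c)%g != 1%g.
  by apply: contra_neq g1 => e; rewrite -[g](conjgK c) e conj1g.
have [d] := IH _ sz g'1.
by rewrite -conjgM; exists (c * d)%g.
Qed.

(** The elements [b] and [c] are the first and the last syllable of [h] when
    these lie in the factor [i], and trivial otherwise. *)
Lemma factor_or_surrounded i h :
  (exists b : A i, h = fpin b) \/
  exists (b c : A i) x s (r : reduced (x :: s)),
    [/\ h = (fpin b * FreeProd r * fpin c)%g, tag x != i & tag (last x s) != i].
Proof.
have [b [t [rt [ht ti]]]] : exists (b : A i) t (rt : reduced t),
    h = (fpin b * FreeProd rt)%g /\ if t is x :: _ then tag x != i else true.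
  case: h => -[|x s] rs.
    by exists 1%g, [::], rs; rewrite fpin1 mul1g.
  have [xi|xi] := eqVneq (tag x) i; last first.
    by exists 1%g, (x :: s), rs; rewrite fpin1 mul1g.
  case: x xi rs => j a /= ji rs; subst j.
  exists a, s, (reduced_behead rs); split; last first.
    case/andP: (rs) => _; case: (s) => //= y u /andP[h _].
      by rewrite eq_sym.
  have a1 : a != 1%g by case/andP: (rs) => /= /andP[].
  by apply/val_inj; rewrite val_mulg val_fpin //= fpcons_id.
case: t rt ht ti => [|x s] rt -> xi.
  left; exists b; rewrite (_ : FreeProd rt = 1%g) ?mulg1//.
  exact/val_inj.
right; have [yi|yi] := eqVneq (tag (last x s)) i; last first.
  by exists b, 1%g, x, s, rt; rewrite fpin1 mulg1.
case/lastP: s rt yi => [|s y] rt; rewrite ?last_rcons /= => yi.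
  by rewrite yi eqxx in xi.
case: y yi rt => j a /= ji; subst j => rt.
have rt' : reduced (x :: s).
  by move: (rt); rewrite -rcons_cons -cats1; apply: reduced_prefix.
have a1 : a != 1%g.
  by case/andP: (rt) => /=; rewrite all_rcons => /and3P[].
exists b, a, x, s, rt'; split=> //.
  rewrite -mulgA; congr (_ * _)%g; apply/val_inj.
  rewrite val_mulg val_fpin//.
  have e : x :: rcons s (syl a) = (x :: s) ++ [:: syl a].
    by rewrite -cats1.
  by rewrite [RHS]fpcat_reduced_cat -e.
by move: (rt); rewrite -cats1 reduced_cat => /and3P[].
Qed.

(** If [h = b m c] where [m] neither begins nor ends in the factor of [a], then
    conjugating [a (h a h^-1)] by [b] gives the word [a' m a'' m^-1] with
    conjugates [a'] and [a''] of [a] inside the factor.  It is reduced, and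
    cyclically so since [m^-1] does not end in that factor. *)
Lemma conj_cyclically_reduced i (a : A i) h : a != 1%g ->
  (forall b : A i, h <> fpin b) ->
  exists c, cyclically_reduced ((fpin a * (fpin a ^ h^-1)) ^ c)%g.
Proof.
move=> a1 hb; have [[b /hb//]|] := factor_or_surrounded i h.
move=> [b [c [x [s [r [-> xi yi]]]]]].
pose a1' := (a ^ b)%g; pose a2 := (a ^ c^-1)%g.
have cj1 (d : A i) : (a ^ d)%g != 1%g.
  by apply: contra_neq a1 => e; rewrite -[a](conjgK d) e conj1g.
have a1'1 : a1' != 1%g := cj1 b.
have a21 : a2 != 1%g := cj1 _.
set m := FreeProd r; exists (fpin b).
have E : ((fpin a * fpin a ^ (fpin b * m * fpin c)^-1) ^ fpin b)%g =
    (fpin a1' * (m * (fpin a2 * m^-1)))%g.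
  rewrite conjMg -conjgM /a1' /a2 !fpinJ fpinV; congr (_ * _)%g.
  rewrite (_ : _ * fpin b = (fpin c)^-1 * m^-1)%g; last first.
    by rewrite !invgM -!mulgA mulVg mulg1.
  by rewrite conjgM [RHS]mulgA [in LHS]conjgE invgK mulgA.
have ri : reduced (syl a2 :: fpinv (x :: s)).
  have -> : syl a2 :: fpinv (x :: s) = fpinv (rcons (x :: s) (syl (a2^-1)%g)).
    by rewrite fpinv_rcons /sylV /= invgK.
  apply: fpinv_reduced; rewrite -cats1 /= reduced_cat r /= yi andbT.
  rewrite /reduced /= !andbT; apply: contra_neq a21.
  by move=> e; rewrite -[a2]invgK e invg1.
have rv : reduced (syl a1' :: (x :: s) ++ syl a2 :: fpinv (x :: s)).
  rewrite reduced_cat ri /= yi !andbT -[_ :: _]/(syl a1' :: [::] ++ x :: s).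
  by rewrite reduced_cat r /reduced /= a1'1 eq_sym xi.
have -> : ((fpin a * fpin a ^ (fpin b * m * fpin c)^-1) ^ fpin b)%g =
    FreeProd rv.
  rewrite E; apply/val_inj.
  rewrite !val_mulg !val_fpin// [val m^-1%g]/=.
  rewrite [fpcat [:: _] (fpinv _)]/= fpcons_id//.
  rewrite [fpcat (x :: s) _]fpcat_reduced_cat ?(reduced_behead rv)//.
  by rewrite [LHS]fpcons_id.
rewrite cyclically_reduced_cons last_cat /= fpinv_cons last_rcons.
by rewrite /sylV.
Qed.

End Words.

(** * Invariant means on amenable subgroups *)

Section Means.
Variables (R : realType) (G : groupType).
Implicit Types (A B H X Y : set G) (nu : set G -> R).

(** The mean lives on the whole group but is invariant under [B] only.  The
    attracting sets used below are subsets of the group defined by their words,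
    without reference to [B]. *)
Definition invariant_mean B nu : Prop :=
  [/\ forall X, 0 <= nu X, nu setT = 1,
      forall X Y, X `&` Y = set0 -> nu (X `|` Y) = nu X + nu Y &
      forall b X, B b -> nu [set x | X (b * x)%g] = nu X].

Definition conj_subgroup A (c : G) : set G := [set b | A (c * b * c^-1)%g].

Lemma subgroup_conj A c : subgroup A -> subgroup (conj_subgroup A c).
Proof.
move=> [A1 AM AV]; split; rewrite /conj_subgroup /=.
- by rewrite mulg1 mulgV.
- move=> g h Ag Ah.
  have -> : (c * (g * h) * c^-1 = (c * g * c^-1) * (c * h * c^-1))%g.
    by rewrite !mulgA mulgVK.
  exact: AM.
- move=> g Ag.
  have -> : (c * g^-1 * c^-1 = (c * g * c^-1)^-1)%g.
    by rewrite !invgM invgK mulgA.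
  exact: AV.
Qed.

(** The conjugate [c^-1 A c] inherits the mean of [A], transported by
    [a |-> c^-1 a c] and concentrated on the conjugate. *)
Lemma amenable_invariant_mean A c : subgroup A -> amenable R A ->
  exists nu, invariant_mean (conj_subgroup A c) nu.
Proof.
move=> [A1 AM AV] [mu [mu0 muA muU muJ]].
pose r X := [set a | A a /\ X (c^-1 * a * c)%g].
have rA X : r X `<=` A by move=> a [].
exists (fun X => mu (r X)); split.
- by move=> X; apply: mu0.
- by rewrite -[RHS]muA; congr mu; apply/seteqP; split=> [a []|a Aa].
- move=> X Y XY; rewrite -muU//; last first.
    apply/seteqP; split=> // a [[_ Xa] [_ Ya]].
    have : (X `&` Y) (c^-1 * a * c)%g by [].
    by rewrite XY.
  congr mu; apply/seteqP; split=> a; first by move=> [Aa [Xa|Ya]]; [left|right].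
  by move=> [[Aa Xa]|[Aa Xa]]; split=> //; [left|right].
- move=> b X Ab; rewrite -[RHS](muJ _ _ (AV _ Ab))//; congr mu.
  have e a : (b * (c^-1 * a * c) = c^-1 * (c * b * c^-1 * a) * c)%g.
    by rewrite !mulgA mulVg mul1g.
  apply/seteqP; split=> a /=.
    move=> [Aa]; rewrite /= e => Xa; exists (c * b * c^-1 * a)%g.
      by split=> //; apply: AM.
    by rewrite mulgA mulVg mul1g.
  move=> [x [Ax Xx] <-]; split; first exact/AM/Ax/AV.
  by rewrite /= e mulVKg.
Qed.

Section MeanTheory.
Variables (B : set G) (nu : set G -> R).
Hypotheses (sB : subgroup B) (mB : invariant_mean B nu).

Lemma mean_diff X Y : X `<=` Y -> nu (Y `\` X) = nu Y - nu X.
Proof.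
have [_ _ nuU _] := mB => XY.
have -> : nu Y = nu (X `|` (Y `\` X)).
  congr nu; apply/seteqP; split=> x.
    by have [|] := pselect (X x); [left|right].
  by move=> [/XY//|[]].
rewrite nuU; first by rewrite addrAC subrr add0r.
by apply/seteqP; split=> // x [Xx [_ /(_ Xx)]].
Qed.

(** Two sets of full measure, [X] and its translate, cannot be disjoint. *)
Lemma mean_translate_meet X b : B b -> nu X = 1 ->
  exists x, X x /\ X (b * x)%g.
Proof.
have [nu0 nuT nuU nuJ] := mB => Bb X1; apply: contrapT => nX.
suff : nu ([set x | X (b * x)%g] `|` X) <= 1.
  rewrite nuU ?nuJ// ?X1; first by rewrite gerDl ler10.
  by apply/seteqP; split=> // x [bx Xx]; apply: nX; exists x.
rewrite -subr_ge0 -nuT -mean_diff //.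
Qed.

Lemma subgroupX g k : B g -> B (g ^+ k)%g.
Proof.
case: sB => B1 BM _ Bg; elim: k => [|k IH]; first by rewrite expg0.
by rewrite expgS; apply: BM.
Qed.

(** The translates of [H] by powers of [g] decrease but all have the same
    measure, so the points lying in one of them and not in a smaller one form a
    null set. *)
Lemma mean_attracting_set H g k : B g -> (forall u, H u -> H (g * u)%g) ->
  nu [set u | H (g ^- k * u)%g \/ ~ H (g ^+ k * u)%g] = 1.
Proof.
have [nu0 nuT nuU nuJ] := mB => Bg gH.
have gkH n u : H u -> H (g ^+ n * u)%g.
  elim: n u => [|n IH] u Hu; first by rewrite expg0 mul1g.
  by rewrite expgS -mulgA; apply/gH/IH.
have [_ _ BV] := sB.
have e1 : nu [set u | H (g ^+ k * u)%g] = nu H by apply/nuJ/subgroupX.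
have e2 : nu [set u | H (g ^- k * u)%g] = nu H by apply/nuJ/BV/subgroupX.
pose D := [set u | H (g ^+ k * u)%g] `\` [set u | H (g ^- k * u)%g].
have D0 : nu D = 0.
  rewrite mean_diff ?e1 ?e2 ?subrr// => u /= /(gkH (k + k)%N).
  by rewrite expgnDr mulgA mulgK.
have -> : [set u | H (g ^- k * u)%g \/ ~ H (g ^+ k * u)%g] = setT `\` D.
  apply/seteqP; split=> u /=.
    by move=> [a|a]; split=> // -[].
  move=> [_ nD]; have [a|a] := pselect (H (g ^- k * u)%g); first by left.
  by right=> b; apply: nD.
by rewrite mean_diff// nuT D0 subr0.
Qed.

End MeanTheory.
End Means.

(** * Subgroups containing a cyclically reduced word *)

Section Axis.
Variables (I : choiceType) (A : I -> groupType).
Local Notation word := (seq (syllable A)).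
Implicit Types (s t u v w : word) (g h b : freeProd A).

Definition repeat k w : word := flatten (nseq k w).

Lemma repeat_reduced k w v :
  reduced (w ++ w) -> reduced (w ++ v) -> reduced (repeat k w ++ v).
Proof.
case: w => [|x s]; first by elim: k.
rewrite /= !reduced_cat => /and3P[rw _ fw] /and3P[_ rv fv].
elim: k => //= k IH; rewrite -catA reduced_cat rw IH /=.
by case: k {IH}.
Qed.

Lemma size_repeat k w : size (repeat k w) = (k * size w)%N.
Proof. by rewrite /repeat size_flatten /shape map_nseq sumn_nseq mulnC. Qed.

Lemma val_expgM g h k :
  reduced (val g ++ val g) -> reduced (val g ++ val h) ->
  val (g ^+ k * h)%g = repeat k (val g) ++ val h.
Proof.
move=> rg rh; elim: k => [|k IH]; first by rewrite expg0 mul1g.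
rewrite expgS -mulgA val_mulg IH [repeat k.+1 _]/= fpcat_reduced_cat.
  by rewrite catA.
by rewrite catA; apply: (@repeat_reduced k.+1).
Qed.

Lemma reduced_fpinv_cat g v : cyclically_reduced g -> reduced v ->
  ~ reduced (val g ++ v) -> reduced (fpinv (val g) ++ v).
Proof.
case: g => -[|x s] rs; first by [].
rewrite cyclically_reduced_cons /= => lx rv; rewrite reduced_cat rs rv /= => nf.
rewrite fpinv_cons reduced_rcons_cat -fpinv_cons fpinv_reduced// rv /=.
case: v {rv} nf => //= y v /negP; rewrite negbK => /eqP <-.
by rewrite eq_sym.
Qed.

Definition begins_along N w : set (freeProd A) :=
  [set u | exists2 e, e \in [:: repeat N w; repeat N (fpinv w)] &
    exists v, val u = e ++ v].

(** The set [H] of the words that can be appended to [g] is attracting for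
    [g].  An element of [g ^+ N H] begins with [g ^+ N]; and if
    [v = g ^+ N * u] is not in [H], then its first syllable lies in the factor
    of the last syllable of [g], so it can be appended to [g^-1], and
    [u = g ^- N * v] begins with [g ^- N]. *)
Lemma mean_begins_along (R : realType) (B : set (freeProd A))
    (nu : set (freeProd A) -> R) g N :
  subgroup B -> invariant_mean B nu -> B g -> cyclically_reduced g ->
  nu (begins_along N (val g)) = 1.
Proof.
move=> sB mB Bg cg; have /andP[_ rg] := cg.
pose H := [set u : freeProd A | reduced (val g ++ val u)].
have gH h : H h -> H (g * h)%g.
  move=> gh; suff: reduced (val g ++ val (g * h)%g) by [].
  have := val_expgM 1 rg gh; rewrite expg1 => ->.
  have := repeat_reduced 2 rg gh.
  by rewrite /repeat /= cats0 -catA.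
have := mean_attracting_set sB mB N Bg gH.
have nu0 : forall X, 0 <= nu X by case: mB.
have nuT : nu setT = 1 by case: mB.
set X := [set u | _ \/ _] => X1.
have XY : X `<=` begins_along N (val g).
  move=> u [hu|hu].
    exists (repeat N (val g)); rewrite ?inE ?eqxx//.
    exists (val (g ^- N * u)%g); rewrite -val_expgM//.
    by rewrite mulgA mulgV mul1g.
  exists (repeat N (fpinv (val g))); rewrite ?inE ?eqxx ?orbT//.
  exists (val (g ^+ N * u)%g); rewrite -[fpinv _]/(val g^-1%g) -val_expgM.
  - by rewrite expVgn mulgA mulVg mul1g.
  - by rewrite /= -fpinv_cat; apply: fpinv_reduced.
  - by apply: reduced_fpinv_cat => //; apply: valP.
apply/eqP; rewrite eq_le; apply/andP; split.
  by rewrite -nuT -subr_ge0 -(mean_diff mB).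
by rewrite -X1 -subr_ge0 -(mean_diff mB).
Qed.

(** In the Cayley graph for the generating set of all syllables, the prefixes
    of the powers of [w] and [w^-1] form the axis of [w], and [s t^-1] moves the
    point [t] of the axis to the point [s]. *)
Definition axis_elements N w : seq (freeProd A) :=
  let ps := [seq take i e | e <- [:: repeat N w; repeat N (fpinv w)],
                            i <- iota 0 N] in
  [seq insubd (1%g : freeProd A) (fpcat s (fpinv t)) | s <- ps, t <- ps].

Lemma size_axis_elements N w : size (axis_elements N w) = (4 * N ^ 2)%N.
Proof. by rewrite /axis_elements !size_allpairs size_iota /= -mulnn; lia. Qed.

(** Some [x] is such that both [x] and [b x] begin with a power [N] or [-N] of
    [g].  What remains of [b x] and [x] after the cancellation in
    [b = (b x) x^-1] has total length less than [N] and is therefore contained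
    in these powers. *)
Lemma mem_axis_elements (R : realType) (B : set (freeProd A))
    (nu : set (freeProd A) -> R) g N b :
  subgroup B -> invariant_mean B nu -> B g -> cyclically_reduced g ->
  B b -> (size (val b) + 2 <= N)%N -> b \in axis_elements N (val g).
Proof.
move=> sB mB Bg cg Bb bN.
have [x [[e eg [v xE]] [e' e'g [v' bxE]]]] :=
  mean_translate_meet mB Bb (mean_begins_along N sB mB Bg cg).
have [s1 [s2 [t1 [es et est sz]]]] :=
  fpcat_cancel (valP (b * x)%g) (valP x^-1%g).
have bE : val b = fpcat s1 t1 by rewrite -est -val_mulg mulgK.
have {}sz : (size s1 + size t1 < N)%N.
  apply: leq_trans bN; rewrite bE -est addnS ltnS.
  by apply: leq_trans sz _; rewrite addn1.
have sg : (0 < size (val g))%N by case/andP: cg; case: (val g).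
have sN f : f \in [:: repeat N (val g); repeat N (fpinv (val g))] ->
    (N <= size f)%N.
  by rewrite !inE => /orP[] /eqP ->; rewrite size_repeat ?size_fpinv leq_pmulr.
have xt : val x = fpinv t1 ++ s2.
  by rewrite -[s2]fpinvK -fpinv_cat -et /= fpinvK.
have e1 : s1 = take (size s1) e'.
  have := congr1 (take (size s1)) bxE.
  rewrite es (take_size_cat s2 erefl) => {1}->.
  by rewrite takel_cat//; apply: leq_trans (sN _ e'g); lia.
have e2 : t1 = fpinv (take (size t1) e).
  have := congr1 (take (size t1)) xE.
  rewrite xt (take_size_cat s2) ?size_fpinv//.
  move=> /(congr1 (@fpinv _ _)); rewrite fpinvK => {1}->.
  by rewrite takel_cat//; apply: leq_trans (sN _ eg); lia.
rewrite /axis_elements; apply/allpairsP; exists (s1, fpinv t1); split.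
- apply/allpairsP; exists (e', size s1); split=> //=.
  by rewrite mem_iota; exact: leq_ltn_trans (leq_addr _ _) sz.
- apply/allpairsP; exists (e, size t1); split=> //; last first.
    by rewrite -[RHS]fpinvK -e2.
  by rewrite mem_iota; exact: leq_ltn_trans (leq_addl _ _) sz.
- by rewrite [RHS]/= fpinvK -bE valKd.
Qed.

End Axis.

(** * Polynomial growth *)

Section Growth.
Variables (R : realType) (G : groupType).
Implicit Types (L : G -> R) (A : set G).

Definition polynomial_growth L A : Prop :=
  exists C D k : nat, forall N : nat, exists2 S : seq G,
    (size S <= C * (N + D) ^ k)%N & forall a, A a -> L a <= N%:R -> a \in S.

Lemma counting_le_size (A : set G) (S : seq G) :
  (forall a, A a -> a \in S) -> (counting A <= (size S)%:R%:E :> \bar R)%E.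
Proof.
move=> AS; have fA : finite_set A.
  by apply: sub_finite_set (finite_seq S) => a /AS.
rewrite /counting asboolT// lee_fin ler_nat.
apply: leq_trans (size_undup S); apply: uniq_leq_size; first exact: fset_uniq.
by move=> a; rewrite in_fset_set// inE mem_undup => /AS.
Qed.

Lemma polynomial_growth_not_super L A :
  polynomial_growth L A -> ~ superpolynomial (growth L A).
Proof.
move=> [C [D [k AS]]]; apply.
exists (C%:R *: ('X + D.+1%:R%:P) ^+ k) => r r0.
have [S sS inS] := AS (Num.truncn r).+1.
apply: (@le_trans _ _ (size S)%:R%:E).
  apply: counting_le_size => a [Aa La]; apply: inS => //.
  by apply: le_trans La _; apply/ltW; rewrite truncnS_gt.
rewrite lee_fin hornerZ horner_exp hornerD hornerX hornerC.
apply: (@le_trans _ _ (C * ((Num.truncn r).+1 + D) ^ k)%:R).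
  by rewrite ler_nat.
rewrite natrM natrX ler_wpM2l// lerXn2r ?nnegrE ?addr_ge0//.
rewrite addSnnS natrD lerD2r.
by rewrite truncn_le.
Qed.

Lemma polynomial_growth_conj L A c : length_function L ->
  polynomial_growth L (conj_subgroup A c) -> polynomial_growth L A.
Proof.
move=> [L0 LM LV _] [C [D [k AS]]].
pose E := (Num.truncn (L c)).+1.
exists C, (E + E + D)%N, k => N; have [S sS inS] := AS (N + (E + E))%N.
exists [seq (c * b * c^-1)%g | b <- S]; first by rewrite size_map addnA.
move=> a Aa La; apply/mapP; exists (c^-1 * a * c)%g; last first.
  by rewrite !mulgA mulgV mul1g mulgK.
apply: inS; first by rewrite /conj_subgroup /= !mulgA mulgV mul1g mulgK.
have LcE : L c <= E%:R by apply/ltW; rewrite truncnS_gt.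
apply: le_trans (LM _ _) _; apply: le_trans (lerD (LM _ _) (lexx _)) _.
by rewrite -LV !natrD; lra.
Qed.

End Growth.

(** * The weighted word length *)

Lemma abszD_le (a b : int) : (absz (a + b)%R <= absz a + absz b)%N.
Proof. by lia. Qed.

Lemma word_val_cons x s : word_val (x :: s) = (letter_val x * word_val s)%g.
Proof. by rewrite /word_val big_cons. Qed.

Lemma word_val1 x : word_val [:: x] = letter_val x.
Proof. by rewrite /word_val big_seq1. Qed.

Section WeightedLength.
Variables (R : realType) (w : forall n : nat, 'I_n.+1 -> R).
Hypothesis w_ge : forall n (i : 'I_n.+1), n.+1%:R <= @w n i.
Local Notation L := (weighted_length w).

Lemma weight_cat s t : weight w (s ++ t) = weight w s + weight w t.
Proof. exact: big_cat. Qed.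

Lemma word_val_inv s :
  exists2 t, word_val t = ((word_val s)^-1)%g & weight w t = weight w s.
Proof.
elim: s => [|x s [t tE wt]].
  by exists [::]; rewrite /word_val ?big_nil ?invg1.
exists (t ++ [:: (x.1, ~~ x.2)]).
  rewrite word_val_cat tE word_val1 word_val_cons invgM; congr (_ * _)%g.
  by case: x => a []; rewrite /letter_val /= ?invgK.
by rewrite weight_cat wt /weight big_seq1 big_cons addrC.
Qed.

Lemma weighted_length_function : length_function L.
Proof.
have LV g : L (g^-1)%g <= L g.
  have [[s sg <-] _] := weighted_length_min w_ge g.
  have [t ts <-] := word_val_inv s.
  by have [_ ->//] := weighted_length_min w_ge g^-1%g; rewrite ts sg.
split.
- move=> g; have [[s _ <-] _] := weighted_length_min w_ge g.
  exact: weight_ge0.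
- move=> g h; have [[s sg <-] _] := weighted_length_min w_ge g.
  have [[t th <-] _] := weighted_length_min w_ge h.
  rewrite -weight_cat; have [_ ->//] := weighted_length_min w_ge (g * h)%g.
  by rewrite word_val_cat sg th.
- by move=> g; apply/le_anti; rewrite LV -{1}[g]invgK LV.
- apply/le_anti; have [[s _ e] le1] := weighted_length_min w_ge 1%g.
  rewrite -{2}e weight_ge0// andbT; apply: le_trans (le1 [::] _) _.
    by rewrite /word_val big_nil.
  by rewrite /weight big_nil.
Qed.

Definition syllable_norm (x : syllable Zpower) : nat :=
  (\sum_j `|(tagged x : 'rV[int]_(tag x).+1) 0%R j|)%N.

(** The sum of the l^1 norms of the syllables is the word length of the element
    for the unweighted generators.  It is at most the weighted length, and it
    dominates both the number of syllables and, in a factor, each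
    coordinate. *)
Definition word_norm (s : seq (syllable Zpower)) : nat :=
  (\sum_(x <- s) syllable_norm x)%N.

Lemma word_norm_fpcons x s :
  (word_norm (fpcons x s) <= syllable_norm x + word_norm s)%N.
Proof.
rewrite /fpcons; case: eqP => _; first exact: leq_addl.
case: s => [|y s]; first by rewrite /word_norm big_seq1 big_nil addn0.
case: ifPn => [_|]; first by rewrite /word_norm big_cons.
case: x y => [n a] [m b]; rewrite negbK => /eqP /= nm; subst m.
rewrite tagged_asE /word_norm big_cons addnA; case: eqP => _.
  exact: leq_addl.
rewrite big_cons leq_add2r /syllable_norm /= -big_split /=.
apply: leq_sum => j _.
change (absz (((a : 'rV[int]_n.+1) + (b : 'rV[int]_n.+1))%R 0%R j) <=
  absz ((a : 'rV[int]_n.+1) 0%R j) + absz ((b : 'rV[int]_n.+1) 0%R j))%N.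
rewrite mxE; exact: abszD_le.
Qed.

Lemma word_norm_fpcat s t :
  (word_norm (fpcat s t) <= word_norm s + word_norm t)%N.
Proof.
elim: s => [|x s IH] /=; first by rewrite leq_addl.
apply: leq_trans (word_norm_fpcons _ _) _.
by rewrite /word_norm big_cons -addnA leq_add2l.
Qed.

Lemma word_norm_fpinv s : word_norm (fpinv s) = word_norm s.
Proof.
rewrite /word_norm /fpinv (perm_big _ (permEl (perm_rev _))) big_map.
apply: eq_bigr => -[n a] _; apply: eq_bigr => j _ /=.
change (absz ((- (a : 'rV[int]_n.+1)) 0 j) = absz ((a : 'rV[int]_n.+1) 0 j)).
by rewrite mxE abszN.
Qed.

Lemma word_norm_letter x : (word_norm (val (letter_val x)) <= 1)%N.
Proof.
suff gen1 n (i : 'I_n.+1) : (word_norm (val (gen i)) <= 1)%N.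
  by case: x => a [] /=; rewrite /letter_val /= ?word_norm_fpinv gen1.
apply: leq_trans (word_norm_fpcons _ _) _.
rewrite /word_norm big_nil addn0 /syllable_norm /= (bigD1 i)//= big1 ?addn0.
  by rewrite mxE !eqxx.
by move=> j ji; rewrite mxE (negbTE ji) andbF.
Qed.

Lemma word_norm_le_length g : (word_norm (val g))%:R <= L g.
Proof.
have [[s <- <-] _] := weighted_length_min w_ge g.
apply: (@le_trans _ _ (size s)%:R).
  rewrite ler_nat; elim: s => [|x s IH].
    by rewrite /word_val big_nil /word_norm big_nil.
  rewrite word_val_cons val_mulg; apply: leq_trans (word_norm_fpcat _ _) _.
  by rewrite /= -add1n; apply: leq_add => //; apply: word_norm_letter.
rewrite /weight -sum1_size natr_sum; apply: ler_sum => x _.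
by apply: le_trans (w_ge _); rewrite ler1n.
Qed.

Lemma size_le_word_norm s : reduced s -> (size s <= word_norm s)%N.
Proof.
elim: s => // x s IH rx; rewrite /word_norm big_cons /= -add1n leq_add//.
  have : tagged x != 1%g by case/andP: rx => /= /andP[].
  rewrite lt0n sum_nat_eq0; apply: contra => /forallP x0; apply/eqP.
  apply/(@rowP int (tag x).+1) => j; have := x0 j; rewrite absz_eq0 => /eqP ->.
  by rewrite mxE.
exact/IH/reduced_behead/rx.
Qed.

Lemma size_le_length g : (size (val g))%:R <= L g.
Proof.
apply: le_trans (word_norm_le_length g); rewrite ler_nat.
exact/size_le_word_norm/valP.
Qed.

Lemma coord_le_length n (v : 'rV[int]_n.+1) (j : 'I_n.+1) :
  (absz (v 0 j))%:R <= L (@fpin _ Zpower n v).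
Proof.
apply: le_trans (word_norm_le_length _); rewrite ler_nat.
have [v0|v0] := eqVneq (v : Zpower n) 1%g.
  by rewrite v0 [X in absz X]mxE.
rewrite val_fpin// /word_norm big_seq1 /syllable_norm /=.
by rewrite (bigD1 j)//= leq_addr.
Qed.

End WeightedLength.

(** * Growth of amenable subgroups *)

Section AmenableGrowth.
Variables (R : realType) (w : forall n : nat, 'I_n.+1 -> R).
Hypothesis w_ge : forall n (i : 'I_n.+1), n.+1%:R <= @w n i.
Local Notation L := (weighted_length w).
Implicit Types (A : set freeProdZ) (c g : freeProdZ).

Lemma polynomial_growth_axis A c g : subgroup A -> amenable R A ->
  A g -> cyclically_reduced (g ^ c)%g -> polynomial_growth L A.
Proof.
move=> sA aA Ag cg; apply: (polynomial_growth_conj (c := c)).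
  exact: weighted_length_function.
have [nu mB] := amenable_invariant_mean c sA aA.
exists 4%N, 2%N, 2%N => N.
exists (axis_elements (N + 2) (val (g ^ c)%g)).
  by rewrite size_axis_elements.
move=> b Bb bN; apply: (mem_axis_elements (subgroup_conj c sA) mB) => //.
  by rewrite /conj_subgroup /= conjgE !mulgA mulgV mul1g mulgK.
by rewrite leq_add2r -(ler_nat R); apply: le_trans (size_le_length w_ge b) bN.
Qed.

(** The coordinates of an element of length at most [N] lie between [-N] and
    [N]. *)
Lemma polynomial_growth_factor A n :
  (forall g, A g -> exists v : Zpower n, g = fpin v) -> polynomial_growth L A.
Proof.
move=> An; exists (2 ^ n.+1)%N, 1%N, n.+1 => N.
exists [seq @fpin _ Zpower n (\row_j ((f j : nat)%:Z - N%:Z)) |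
  f : {ffun 'I_n.+1 -> 'I_(2 * N).+1} <- enum {ffun 'I_n.+1 -> 'I_(2 * N).+1}].
  rewrite size_map -cardE card_ffun !card_ord -expnMn leq_exp2r//; lia.
move=> g /An[v ->] vN; apply/mapP.
have vj j : (absz ((v : 'rV[int]_n.+1) 0%R j) <= N)%N.
  by rewrite -(ler_nat R); apply: le_trans (coord_le_length w_ge _ _) vN.
exists [ffun j => inord (absz ((v : 'rV[int]_n.+1) 0 j + N%:Z))].
  by rewrite mem_enum.
congr fpin; apply/(@rowP int n.+1) => j; rewrite mxE ffunE.
have := vj j; move: (_ 0 j) => z zN.
by rewrite inordK; lia.
Qed.

(** If one nontrivial element is conjugated into a factor, then either all the
    others follow it there, or one that does not yields a cyclically reduced
    conjugate. *)
Lemma amenable_polynomial_growth A : subgroup A -> amenable R A ->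
  polynomial_growth L A.
Proof.
move=> sA aA.
have [[g [Ag g1]]|A1] := pselect (exists g, A g /\ g != 1%g); last first.
  exists 1%N, 0%N, 0%N => N; exists [:: 1%g] => // a Aa _; rewrite inE.
  by apply: contraT => a1; case: A1; exists a.
have [c [[n [v [v1 gc]]]|]] := conj_fpin_or_cyclically_reduced g1; last first.
  exact: polynomial_growth_axis.
have [Bn|/existsNP[h /not_implyP[Bh hn]]] := pselect
    (forall h, conj_subgroup A c h -> exists v : Zpower n, h = fpin v).
  apply: (polynomial_growth_conj (c := c)).
    exact: weighted_length_function.
  exact: polynomial_growth_factor Bn.
have [sB1 sBM sBV] := subgroup_conj c sA.
have Bv : conj_subgroup A c (fpin v).
  by rewrite /conj_subgroup /= -gc conjgE !mulgA mulgV mul1g mulgK.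
have hn' (b : Zpower n) : h <> fpin b by move=> e; apply: hn; exists b.
have [d cd] := conj_cyclically_reduced v1 hn'.
set k := (fpin v * _)%g in cd.
have Bk : conj_subgroup A c k.
  by rewrite /k conjgE invgK; do !apply: (sBM) => //; apply: sBV.
apply: (@polynomial_growth_axis A (c * d)%g (k ^ c^-1)%g) => //.
  by rewrite conjgE invgK mulgA.
by rewrite conjgM conjgKV.
Qed.

End AmenableGrowth.

(** * Failure of property RD *)

Section RD.
Variables (R : realType) (G : groupType).
Implicit Types (X Y : {fset G}) (L : G -> R).

Let indic X : G -> R := fun g => (g \in X)%:R.

Lemma finitely_supported_indic X : finitely_supported (indic X).
Proof.
apply: sub_finite_set (finite_fset X) => g /=.
by rewrite /indic; case: (g \in X); rewrite ?eqxx.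
Qed.

Lemma l2norm_sqr (phi : G -> R) X : (forall g, g \notin X -> phi g = 0) ->
  l2norm phi ^+ 2 = \sum_(g <- X) phi g ^+ 2.
Proof.
move=> phi0; rewrite /l2norm sqr_sqrtr ?(fsbigTE X).
- by [].
- by move=> g gX; rewrite phi0// expr0n.
- by apply: sumr_ge0 => g _; apply: sqr_ge0.
- by move=> g gX; rewrite phi0// expr0n.
Qed.

Lemma l2norm_indic X : l2norm (indic X) ^+ 2 = #|` X|%:R.
Proof.
rewrite (l2norm_sqr (X := X)); last by move=> g /negbTE; rewrite /indic => ->.
rewrite big_seq (eq_bigr (fun=> 1)) -?big_seq; last first.
  by move=> g gX; rewrite /indic gX expr1n.
by rewrite big_const_seq count_predT iter_addr_0.
Qed.

Lemma ler_sum_fsubset X Y (F : G -> R) : (X `<=` Y)%fset ->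
  (forall g, 0 <= F g) -> \sum_(g <- X) F g <= \sum_(g <- Y) F g.
Proof.
move=> /fsubsetP XY F0.
rewrite [leLHS](_ : _ = \sum_(g <- Y | g \in X) F g); last first.
  rewrite [RHS]big_mkcond [LHS]big_seq [LHS]big_mkcond /=.
  apply: big_fset_incl; first exact/fsubsetP.
  by move=> g _ /negbTE ->.
by rewrite [leRHS](bigID (mem X)) /= lerDl sumr_ge0.
Qed.

(** For [k] in [Y] the convolution of the indicator functions of [X] and [Y] at
    [k] counts the [g] in [X] with [g^-1 k] in [Y]; all the [k z^-1] with [z]
    in [Y] are such.  So its square norm is at least [|Y|^3], while property RD
    bounds it by [P |X| |Y|]. *)
Lemma property_RD_fsets L P X Y r :
  (forall phi psi,
      finitely_supported phi -> finitely_supported psi ->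
      (forall g, 0 <= phi g) -> (forall g, 0 <= psi g) ->
      propagation L phi <= r ->
      l2norm (convolution phi psi) ^+ 2 <=
        P * l2norm phi ^+ 2 * l2norm psi ^+ 2) ->
  0 < r -> (forall g, g \in X -> L g <= r) ->
  (forall y z, y \in Y -> z \in Y -> (y * z^-1)%g \in X) ->
  (0 < #|` Y|)%N ->
  (#|` Y| ^ 2)%:R <= P * #|` X|%:R.
Proof.
move=> RD r0 XL YX Y0.
have := RD (indic X) (indic Y) (finitely_supported_indic X)
  (finitely_supported_indic Y).
rewrite !l2norm_indic => /(_ (fun=> ler0n _ _) (fun=> ler0n _ _)).
have pX : propagation L (indic X) <= r.
  rewrite /propagation big_seq; apply: bigmax_le; first exact: ltW.
  move=> g; rewrite in_fset_set; last exact: finitely_supported_indic.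
  rewrite inE /= /indic => gX; apply: XL; move: gX.
  by case: (g \in X); rewrite ?eqxx.
move=> /(_ pX); set f := convolution _ _.
have fE k : f k = \sum_(g <- X) (g^-1 * k \in Y)%g%:R.
  rewrite /f /convolution (fsbigTE X).
    by rewrite !big_seq; apply: eq_bigr => g gX; rewrite /indic gX mul1r.
  by move=> g /negbTE gX; rewrite /indic gX mul0r.
have f0 k : k \notin [fset (g * h)%g | g in X, h in Y]%fset -> f k = 0.
  move=> kXY; rewrite fE big_seq big1// => g gX.
  case: (boolP (_ \in Y)) => // gkY; case/negP: kXY; apply/imfset2P.
  by exists g => //; exists (g^-1 * k)%g => //; rewrite mulVKg.
rewrite (l2norm_sqr f0) => le1.
have : (#|` Y| ^ 2)%:R * #|` Y|%:R <= P * #|` X|%:R * #|` Y|%:R.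
  apply: le_trans le1.
  apply: le_trans (ler_sum_fsubset (X := Y) _ _); last 2 first.
  - apply/fsubsetP => y yY; apply/imfset2P.
    exists (y * y^-1)%g; first exact: YX.
    by exists y => //; rewrite mulgVK.
  - by move=> g; apply: sqr_ge0.
  rewrite -[X in _ * X%:R <= _]sum1_size natr_sum mulr_sumr.
  rewrite !big_seq; apply: ler_sum => k kY; rewrite mulr1 natrX.
  rewrite lerXn2r ?nnegrE// ?fE; first by apply: sumr_ge0.
  (* These are the elements of X that contribute 1 to the value at k. *)
  pose X' := [fset (k * z^-1)%g | z in Y]%fset.
  have <- : #|` X'| = #|` Y|.
    by apply: card_imfset => y z /mulgI /invg_inj.
  apply: le_trans (ler_sum_fsubset (X := X') _ _) => //; last first.
    by apply/fsubsetP => _ /imfsetP[z zY ->]; apply: YX.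
  rewrite -sum1_size natr_sum !big_seq; apply: ler_sum => _ /imfsetP[z zY ->].
  by rewrite invgM invgK mulgVK zY.
by rewrite ler_pM2r// ltr0n.
Qed.

End RD.

Section ZpowerCubes.
Variables (R : realType) (w : forall n : nat, 'I_n.+1 -> R).
Hypothesis w_ge : forall n (i : 'I_n.+1), n.+1%:R <= @w n i.
Local Notation L := (weighted_length w).

Lemma length_fpin_le n (v : 'rV[int]_n.+1) :
  L (@fpin _ Zpower n v) <= \sum_j (absz (v 0 j))%:R * w j.
Proof.
have [L0 LM LV L1] := weighted_length_function w_ge.
pose l (u : 'rV[int]_n.+1) := L (@fpin _ Zpower n u).
have l0 : l 0 = 0 by rewrite /l -[RHS]L1 -(@fpin1 _ Zpower n).
have lD u u' : l (u + u') <= l u + l u'.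
  by apply: le_trans (LM _ _); rewrite -fpinM.
have lN u : l (- u) = l u by rewrite /l [RHS]LV -fpinV.
have lgen j : l (delta_mx 0 j) <= w j.
  have [_ le1] := weighted_length_min w_ge (gen j).
  apply: le_trans (le1 [:: (Tagged (fun n => 'I_n.+1) j, false)] _) _.
    by rewrite word_val1.
  by rewrite /weight big_seq1.
have lMn u k : l (u *+ k) <= k%:R * l u.
  elim: k => [|k IH]; first by rewrite mulr0n mul0r l0.
  rewrite mulrS; apply: le_trans (lD _ _) _.
  by rewrite -natr1 mulrDl mul1r addrC lerD2r.
have lZ u (z : int) : l (z *: u) <= (absz z)%:R * l u.
  rewrite -{1}[z]intz scaler_int; case: z => k; first exact: lMn.
  by rewrite NegzE mulrNz lN abszN; apply: lMn.
rewrite -/(l v) [X in l X]row_sum_delta; elim/big_rec2: _ => [|j y x _ IH].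
  by rewrite l0.
apply: le_trans (lD _ _) _; apply: lerD => //.
by apply: le_trans (lZ _ _) _; rewrite ler_wpM2l.
Qed.

(** Points of the cube [-d, K-d) to the power [n+1] in the factor of index
    [n]. *)
Definition cube_point n K d (f : {ffun 'I_n.+1 -> 'I_K}) : freeProdZ :=
  @fpin _ Zpower n (\row_j ((f j : nat)%:Z - d%:Z)).

Definition cube n K d : {fset freeProdZ} :=
  [fset cube_point d f | f in [set: {ffun 'I_n.+1 -> 'I_K}]%SET]%fset.

Lemma card_cube n K d : #|` cube n K d| = (K ^ n.+1)%N.
Proof.
rewrite card_imfset /=; last first.
  move=> f g /fpin_inj /(@rowP int n.+1) fg; apply/ffunP => j.
  by have := fg j; rewrite !mxE => /addIr [] /ord_inj.
by rewrite -cardE cardsT card_ffun !card_ord.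
Qed.

Lemma cube_sub n K y z : y \in cube n K 0 -> z \in cube n K 0 ->
  (y * z^-1)%g \in cube n (2 * K) K.
Proof.
move=> /imfsetP[f _ ->] /imfsetP[g _ ->].
have lt j : (f j + K - g j < 2 * K)%N.
  by have := ltn_ord (f j); have := ltn_ord (g j); lia.
apply/imfsetP; exists [ffun j => Ordinal (lt j)]; first by rewrite /= inE.
rewrite /cube_point -(@fpinV _ Zpower n) -(@fpinM _ Zpower n).
congr fpin; apply/(@rowP int n.+1) => j.
have -> (u v : 'rV[int]_n.+1) :
  ((u : Zpower n) * (v : Zpower n)^-1)%g = u - v by [].
rewrite !mxE ffunE /=; have := ltn_ord (g j).
by move: (nat_of_ord (f j)) (nat_of_ord (g j)) => a b bK; lia.
Qed.

Lemma length_cube_le n K (M : R) g : (forall i : 'I_n.+1, w i <= M) ->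
  g \in cube n (2 * K) K -> L g <= n.+1%:R * (K%:R * M).
Proof.
move=> wM /imfsetP[f _ ->]; apply: le_trans (length_fpin_le _) _.
apply: (@le_trans _ _ (\sum_(j < n.+1) (K%:R * M))); last first.
  by rewrite sumr_const card_ord -[leLHS]mulr_natl.
apply: ler_sum => j _; rewrite ler_pM//.
  by apply: le_trans (w_ge _).
rewrite ler_nat mxE; have := ltn_ord (f j).
by move: (nat_of_ord (f j)) => a; lia.
Qed.

Lemma horner_le_monomial (P : {poly R}) x : (forall i, 0 <= P`_i) -> 1 <= x ->
  P.[x] <= P.[1] * x ^+ size P.
Proof.
move=> P0 x1; rewrite !horner_coef mulr_suml; apply: ler_sum => i _.
by rewrite expr1n mulr1 ler_wpM2l// ler_weXn2l// ltnW.
Qed.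

(** The factor used has rank [m = n + 1] where [n] is the size of the polynomial
    [P], hence at least its degree.  There [r = m K M] bounds the length on
    the cubes, and [P(r) <= P(1) r^n] for [r >= 1], so that property RD would
    give [K^(n+1) <= C K^n] with a constant [C] not depending on [K]. *)
Lemma not_property_RD : (forall n, exists M, forall i : 'I_n.+1, w i <= M) ->
  ~ property_RD L.
Proof.
move=> w_le [P P0 RD]; have [M wM] := w_le (size P).
set n := size P in M wM.
have M1 : 1 <= M.
  by apply: le_trans (wM ord0); apply: le_trans (w_ge _); rewrite ler1n.
pose C := P.[1] * (n.+1%:R * M) ^+ n * 2 ^+ n.+1.
pose K := (Num.truncn C).+1.
have CK : C < K%:R by rewrite truncnS_gt.
have K1 : 1 <= K%:R :> R by rewrite ler1n.
have K0 : 0 < K%:R :> R by rewrite ltr0n.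
pose r := n.+1%:R * (K%:R * M).
have r1 : 1 <= r by rewrite !mulr_ege1// ler1n.
have r0 : 0 < r by apply: lt_le_trans r1.
have H1 : ((K ^ n.+1) ^ 2)%:R <= P.[r] * ((2 * K) ^ n.+1)%:R.
  rewrite -(card_cube n K 0) -(card_cube n (2 * K) K).
  apply: (property_RD_fsets (RD r r0) r0) => [g|y z|].
  - exact: length_cube_le.
  - exact: cube_sub.
  - by rewrite card_cube expn_gt0.
have H2 : K%:R ^+ n.+1 <= P.[r] * 2 ^+ n.+1.
  have Kn0 : 0 < K%:R ^+ n.+1 :> R by rewrite exprn_gt0.
  by have := H1; rewrite !natrX natrM exprMn expr2 mulrA ler_pM2r.
have H3 := horner_le_monomial P0 r1.
have : K%:R <= C.
  have Kn0 : 0 < K%:R ^+ n :> R by rewrite exprn_gt0.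
  rewrite -(ler_pM2r Kn0) -exprS; apply: le_trans H2 _.
  apply: le_trans (ler_wpM2r _ H3) _; first by rewrite exprn_ge0.
  rewrite le_eqVlt; apply/orP; left; apply/eqP.
  by rewrite /C /r -/n [n.+1%:R * _]mulrCA !exprMn; ring.
by rewrite leNgt CK.
Qed.

End ZpowerCubes.

Theorem mainTheorem15 (R : realType) (p : nat -> nat)
    (p_incr : {homo p : m n / (m <= n)%N})
    (w : forall n : nat, 'I_n.+1 -> R)
    (w_bounds : forall n (i : 'I_n.+1), n.+1%:R <= w n i <= (p n.+1)%:R) :
  [/\ length_function (weighted_length w),
      ~ property_RD (weighted_length w) &
      ~ exists A : set freeProdZ, [/\ subgroup A, amenable R A &
          superpolynomial (growth (weighted_length w) A)]].
Proof.
have w_ge n (i : 'I_n.+1) : n.+1%:R <= w n i by case/andP: (w_bounds n i).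
split.
- exact: weighted_length_function.
- apply: not_property_RD => // n; exists (p n.+1)%:R => i.
  by case/andP: (w_bounds n i).
- move=> [A [sA aA]]; apply: polynomial_growth_not_super.
  exact: amenable_polynomial_growth.
Qed.
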